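(* There exist infinitely many (pairwise non-isomorphic) $3$-connected $1$-plane graphs that have no connected spanning plane subgraphs.
   Context: All graphs are finite, simple and undirected. A (plane) drawing of a graph represents the vertices by distinct points of the plane and the edges by non-self-intersecting arcs joining the points of their end vertices and containing no vertex point in their interior. A $1$-plane graph is a graph given together with a plane drawing in which each edge is crossed at most once by another edge, i.e. each edge has at most one crossing point; crossings of adjacent edges are forbidden. A spanning plane subgraph of a $1$-plane graph $G$ is a subgraph $F$ with $V(F)=V(G)$ that is a plane graph with respect to the given drawing of $G$, i.e. no two edges of $F$ cross in that drawing. The connectivity is $\kappa(G)=\min\{p(u,v) : u,v\in V(G), u\neq v\}$, where $p(u,v)$ is the maximum number of pairwise internally vertex-disjoint $uv$-paths; $G$ is $k$-connected if $\kappa(G)\ge k$. *)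

(* Defs.v *)
From HB Require Import structures.
From mathcomp Require Import all_boot all_order all_algebra.
From mathcomp Require Import all_classical all_reals all_analysis.

Set Implicit Arguments.
Unset Strict Implicit.
Unset Printing Implicit Defensive.

Import Order.TTheory GRing.Theory Num.Theory.
Import numFieldNormedType.Exports.

Local Open Scope classical_set_scope.
Local Open Scope ring_scope.

(* Built on MathComp-Analysis: the plane is R * R with its product topology,
   for R : realType. *)

Record sgraph (V : finType) := SGraph {
  edges : {set {set V}};
  card_edge : forall e, e \in edges -> #|e| = 2%N }.

Section GraphTheory.
Variable V : finType.
Implicit Types (G F : sgraph V) (u v : V).

(* Irreflexive, since [set u; u] is a singleton. *)
Definition adj G : rel V := fun u v => [set u; v]%SET \in edges G.

Definition connected_graph G : Prop := forall u v, connect (adj G) u v.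

(* A path is the sequence of its vertices, both ends included; since these are
   distinct, length at most #|V| is no restriction, and it makes the type of
   candidate paths finite. *)
Definition is_path G u v (s : {bseq #|V| of V}) : bool :=
  if s : seq V is x :: s' then
    [&& x == u, path (adj G) x s', last x s' == v & uniq (x :: s')]
  else false.

Definition internally_disjoint u v (s t : {bseq #|V| of V}) : bool :=
  [forall x, (x \in s) && (x \in t) ==> (x == u) || (x == v)].

(* For adjacent u and v, the path [:: u; v] is counted once, as S is a set. *)
Definition max_disjoint_paths G u v : nat :=
  \max_(S : {set {bseq #|V| of V}} |
        [forall s in S, is_path G u v s] &&
        [forall s in S, forall t in S, (s != t) ==> internally_disjoint u v s t])
    #|S|.

(* The unit of the iterated minimum only matters when V has no two distinct
   vertices: pairwise internally disjoint uv-paths have distinct second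
   vertices, all different from u, so there are at most #|V|.-1 of them. *)
Definition kappa G : nat :=
  \big[minn/#|V|.-1]_(w : V * V | w.1 != w.2) max_disjoint_paths G w.1 w.2.

Definition k_connected (k : nat) G : Prop := (k <= kappa G)%N.

End GraphTheory.

Definition isomorphic (V W : finType) (G : sgraph V) (H : sgraph W) : Prop :=
  exists2 f : V -> W, bijective f & forall u v, adj H (f u) (f v) = adj G u v.

Section Drawings.
Variables (R : realType) (V : finType).

Record drawing (G : sgraph V) := Drawing {
  point : V -> R * R;
  (* Parametrised by [0, 1]; values elsewhere, and at non-edges, are junk. *)
  arc : {set V} -> R -> R * R;
  point_inj : injective point;
  arc_continuous : forall e, e \in edges G -> {within `[0, 1], continuous (arc e)};
  arc_inj : forall e, e \in edges G -> {in `[0, 1] &, injective (arc e)};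
  arc_ends : forall e, e \in edges G ->
    exists u v, [/\ e = [set u; v]%SET, arc e 0 = point u & arc e 1 = point v];
  arc_avoids : forall e, e \in edges G ->
    forall t v, t \in `]0, 1[ -> arc e t <> point v }.

(* Some homeomorphism of the plane sends p to the origin and, near p, A to the
   first coordinate axis and B to the second one. *)
Definition transversal_at (A B : set (R * R)) (p : R * R) : Prop :=
  exists phi psi : R * R -> R * R,
    [/\ continuous phi /\ continuous psi, cancel phi psi, cancel psi phi,
        phi p = (0, 0) &
        \forall q \near p, (A q <-> (phi q).2 = 0) /\ (B q <-> (phi q).1 = 0)].

Variables (G : sgraph V) (D : drawing G).

Definition arc_interior (e : {set V}) : set (R * R) := arc D e @` `]0, 1[.

Definition crossing_point (e f : {set V}) (p : R * R) : Prop :=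
  e != f /\ (arc_interior e `&` arc_interior f) p.

Definition cross (e f : {set V}) : Prop := exists p, crossing_point e f p.

(* The first clause excludes touching: wherever two edges meet in their
   interiors, they really cross. The second one bounds both the number of
   crossing points of e and the number of edges crossing e. *)
Definition one_plane : Prop :=
  [/\ forall e f p, e \in edges G -> f \in edges G -> crossing_point e f p ->
        transversal_at (arc_interior e) (arc_interior f) p,
      forall e f g p q,
        e \in edges G -> f \in edges G -> g \in edges G ->
        crossing_point e f p -> crossing_point e g q -> f = g /\ p = q &
      forall e f, e \in edges G -> f \in edges G ->
        ~~ [disjoint e & f] -> ~ cross e f].

Definition spanning_plane_subgraph (F : sgraph V) : Prop :=
  edges F \subset edges G /\
  forall e f, e \in edges F -> f \in edges F -> ~ cross e f.

End Drawings.

Record one_plane_graph (R : realType) := OnePlaneGraph {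
  vertex : finType;
  graph : sgraph vertex;
  graph_drawing : drawing R graph;
  graph_one_plane : one_plane graph_drawing }.

(* Main.v *)
(* The base graph has the 24 vertices of the rhombicuboctahedron, drawn in the
   plane with a triangular outer face; its edges are both diagonals of each of
   the 18 squares and the three sides of the outer triangle. The uncrossed edges
   leave 22 components (the outer triangle and 21 single vertices), whereas a
   plane subgraph keeps at most one edge from each of the 18 crossing pairs, so
   it cannot connect them. To get infinitely many graphs, stack m further
   vertices outside the triangle, each joined to its predecessor and to the two
   other corners of the triangle: this only enlarges one component, and
   3-connectivity persists because every vertex of the base graph has a fan of
   three disjoint paths to the corners of the triangle. *)

Require Import Defs.
From mathcomp Require Import all_boot all_order all_algebra.
From mathcomp Require Import all_classical all_reals all_analysis.
From mathcomp Require Import ring lra zify.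

Set Implicit Arguments.
Unset Strict Implicit.
Unset Printing Implicit Defensive.

Import Order.TTheory GRing.Theory Num.Theory.
Import numFieldNormedType.Exports.

Local Open Scope classical_set_scope.
Local Open Scope ring_scope.

(** * Segments in the plane *)

Section PlaneSegments.
Variable R : realType.
Implicit Types a b c d p q : R * R.

Definition seg a b (t : R) : R * R :=
  (a.1 + t * (b.1 - a.1), a.2 + t * (b.2 - a.2)).

Definition oseg a b : set (R * R) := seg a b @` `]0, 1[.

(* Twice the signed area of the triangle abc. *)
Definition area a b c : R :=
  (b.1 - a.1) * (c.2 - a.2) - (b.2 - a.2) * (c.1 - a.1).

Definition aff (l : R * R * R) p : R := l.1.1 * p.1 + l.1.2 * p.2 + l.2.

Lemma pair_ext p q : p.1 = q.1 -> p.2 = q.2 -> p = q.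
Proof. by case: p q => [? ?] [? ?] /= -> ->. Qed.

Lemma continuous_pair (T : topologicalType) (f g : T -> R) :
  continuous f -> continuous g -> continuous (fun x => (f x, g x)).
Proof. by move=> cf cg x; exact: (cvg_pair (cf x) (cg x)). Qed.

Lemma seg_continuous a b : continuous (seg a b).
Proof.
by apply: continuous_pair => t; apply: cvgD (@cvg_cst _ _ _ _ _) _;
  apply: cvgM cvg_id (@cvg_cst _ _ _ _ _).
Qed.

Lemma seg_inj a b : a <> b -> injective (seg a b).
Proof.
move=> ab s t [/addrI e1 /addrI e2].
have [b1|b1] := eqVneq (b.1 - a.1) 0; last exact: mulIf b1 _ _ e1.
have [b2|b2] := eqVneq (b.2 - a.2) 0; last exact: mulIf b2 _ _ e2.
by case: ab; apply/esym/pair_ext; apply/eqP; rewrite -subr_eq0 ?b1 ?b2.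
Qed.

Lemma seg0 a b : seg a b 0 = a.
Proof. by apply: pair_ext; rewrite /= mul0r addr0. Qed.

Lemma seg1 a b : seg a b 1 = b.
Proof. by apply: pair_ext; rewrite /= mul1r; ring. Qed.

Lemma osegC a b : oseg a b = oseg b a.
Proof.
suff sub c d : oseg c d `<=` oseg d c by apply/seteqP; split; exact: sub.
move=> _ [t /= + <-]; rewrite in_itv /= => /andP[t0 t1].
by exists (1 - t); [rewrite /= in_itv /=; lra | apply: pair_ext => /=; ring].
Qed.

(** * Disjointness of open segments by a separating line *)

Lemma aff_seg l a b t : aff l (seg a b t) = (1 - t) * aff l a + t * aff l b.
Proof. by rewrite /aff /=; ring. Qed.

(** At a common point the functional would be both at most 0 and at least 0. The strict inequality
    puts some end off the line, and an interior point gives both ends positive weight. With [c = d]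
    this says that a point avoids a segment. *)
Lemma oseg_separated l a b c d :
  aff l a <= 0 -> aff l b <= 0 -> 0 <= aff l c -> 0 <= aff l d ->
  aff l a + aff l b < aff l c + aff l d ->
  oseg a b `&` oseg c d = set0.
Proof.
move=> la lb lc ld lt; rewrite -subset0 => p [[s + sp] [t + tp]].
rewrite /= !in_itv /= => /andP[s0 s1] /andP[t0 t1].
have := aff_seg l a b s; have := aff_seg l c d t; rewrite sp tp => -> e.
have [|a0] := ltP (aff l a) 0; first by nra.
have [|b0] := ltP (aff l b) 0; first by nra.
have [|c0] := ltP 0 (aff l c); first by nra.
by have [|d0] := ltP 0 (aff l d); nra.
Qed.

(** The line through [a] and [b] separates: it contains the whole first segment, while [c] or [d]
    lies strictly off it. *)
Lemma oseg_same_side a b c d :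
  0 <= area a b c * area a b d -> (area a b c != 0) || (area a b d != 0) ->
  oseg a b `&` oseg c d = set0.
Proof.
(* [l] is [area a b] written as an affine functional; its negation [l'] serves when [c] and [d] lie
   on the nonpositive side. *)
pose l : R * R * R := (- (b.2 - a.2), b.1 - a.1, (b.2 - a.2) * a.1 - (b.1 - a.1) * a.2).
have lE p : aff l p = area a b p by rewrite /aff /area /=; ring.
pose l' : R * R * R := (- l.1.1, - l.1.2, - l.2).
have l'E p : aff l' p = - area a b p by rewrite -lE /aff /=; ring.
have aa : area a b a = 0 by rewrite /area; ring.
have ab : area a b b = 0 by rewrite /area; ring.
move=> cd ne.
have [[c0 d0]|[c0 d0]] : 0 <= area a b c /\ 0 <= area a b d \/
    area a b c <= 0 /\ area a b d <= 0.
  case: (ltgtP (area a b c) 0) cd ne => [h|h|->]; rewrite ?eqxx ?mul0r ?lexx /=.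
  - by rewrite nmulr_rge0 // => ? _; right; split=> //; exact: ltW.
  - by rewrite pmulr_rge0 // => ? _; left; split=> //; exact: ltW.
  - by move=> _ _; case: (leP 0 (area a b d)) => [?|/ltW ?]; [left|right].
- apply: (@oseg_separated l); rewrite ?lE ?aa ?ab ?lexx //.
  by rewrite addr0 lt_neqAle addr_ge0 // andbT eq_sym paddr_eq0 // negb_and.
- apply: (@oseg_separated l'); rewrite ?l'E ?aa ?ab ?oppr0 ?oppr_ge0 ?lexx //.
  rewrite addr0 -opprD oppr_gt0 lt_neqAle naddr_eq0 // negb_and ne.
  by rewrite -oppr_ge0 opprD addr_ge0 ?oppr_ge0.
Qed.

(** * Proper crossings of segments *)

Definition cross_prod a b c d : R :=
  (b.1 - a.1) * (d.2 - c.2) - (b.2 - a.2) * (d.1 - c.1).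

(** The affine function [area c d] changes sign along the first segment, so it vanishes at an
    interior parameter; the same holds with the roles exchanged, and both parameters give the same
    point. *)
Lemma oseg_meet a b c d :
  area a b c * area a b d < 0 -> area c d a * area c d b < 0 ->
  cross_prod a b c d != 0 /\ oseg a b `&` oseg c d !=set0.
Proof.
(* [x / (x - y)] is the zero of the affine function with value [x] at 0 and [y] at 1. *)
have itv01 (x y : R) : x * y < 0 -> x / (x - y) \in `]0, 1[.
  move=> xy; rewrite in_itv /=.
  case: (ltgtP x 0) => [x0|x0|x0]; last by rewrite x0 mul0r ltxx in xy.
  - have y0 : 0 < y by rewrite nmulr_rlt0 in xy.
    by rewrite ltr_ndivlMr ?ltr_ndivrMr; lra.
  - have y0 : y < 0 by rewrite pmulr_rlt0 in xy.
    by rewrite ltr_pdivlMr ?ltr_pdivrMr; lra.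
move=> h1 h2.
have e1 : area a b c - area a b d = - cross_prod a b c d.
  by rewrite /area /cross_prod; ring.
have e2 : area c d a - area c d b = cross_prod a b c d.
  by rewrite /area /cross_prod; ring.
have nz : cross_prod a b c d != 0.
  rewrite -e2 subr_eq0; apply/negP => /eqP e.
  by move: h2; rewrite e -expr2 ltNge sqr_ge0.
split=> //; exists (seg a b (area c d a / (area c d a - area c d b))).
split; first by exists (area c d a / (area c d a - area c d b)) => //; exact: itv01.
exists (area a b c / (area a b c - area a b d)); first exact: itv01.
rewrite e1 e2; apply: pair_ext => /=; move: nz; rewrite /area /cross_prod => nz; field; lra.
Qed.

(** Eliminating the parameters on the second segment from the two coordinate equations leaves
    [s - s'] times the determinant of the directions. *)
Lemma oseg_meet_unique a b c d p q : cross_prod a b c d != 0 ->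
  (oseg a b `&` oseg c d) p -> (oseg a b `&` oseg c d) q -> p = q.
Proof.
move=> nz [[s _ <-] [t _ e1]] [[s' _ <-] [t' _ e2]].
suff -> : s = s' by [].
case: e1 => x1 y1; case: e2 => x2 y2; apply: (mulIf nz).
have ex : (t - t') * (d.1 - c.1) = (s - s') * (b.1 - a.1) by lra.
have ey : (t - t') * (d.2 - c.2) = (s - s') * (b.2 - a.2) by lra.
by apply/eqP; rewrite -subr_eq0 -mulrBl /cross_prod mulrBr !mulrA -ex -ey; apply/eqP; ring.
Qed.

Lemma near_itv01 (f : R * R -> R) p :
  {for p, continuous f} -> f p \in `]0, 1[ -> \forall q \near p, f q \in `]0, 1[.
Proof. by move=> cf fp; exact: (cf _ (near_in_itvoo fp)). Qed.

(** Affine coordinates with origin [p] and axes along the two segments straighten both at once. *)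
Lemma oseg_transversal a b c d p : cross_prod a b c d != 0 ->
  (oseg a b `&` oseg c d) p -> transversal_at (oseg a b) (oseg c d) p.
Proof.
move=> nz [[s0 s01 ps] [t0 t01 pt]].
have px := congr1 fst ps; have py := congr1 snd ps.
have px' := congr1 fst pt; have py' := congr1 snd pt.
pose D := cross_prod a b c d.
(* Cramer's rule for the coordinates of [q - p] in the basis [b - a], [d - c]; [psi] is the inverse
   map. *)
pose phi q : R * R :=
  (((q.1 - p.1) * (d.2 - c.2) - (q.2 - p.2) * (d.1 - c.1)) / D,
   ((b.1 - a.1) * (q.2 - p.2) - (b.2 - a.2) * (q.1 - p.1)) / D).
pose psi w : R * R :=
  (p.1 + w.1 * (b.1 - a.1) + w.2 * (d.1 - c.1),
   p.2 + w.1 * (b.2 - a.2) + w.2 * (d.2 - c.2)).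
have phip : phi p = (0, 0) by apply: pair_ext; rewrite /= !subrr !(mul0r, mulr0) subrr mul0r.
have phiK : cancel phi psi.
  by move=> q; apply: pair_ext => /=; move: nz; rewrite /D /cross_prod => nz; field.
have psiK : cancel psi phi.
  by move=> q; apply: pair_ext => /=; move: nz; rewrite /D /cross_prod => nz; field.
have c1 : continuous (fst : R * R -> R) by move=> q; exact: cvg_fst.
have c2 : continuous (snd : R * R -> R) by move=> q; exact: cvg_snd.
have cphi1 : continuous (fun q => (phi q).1).
  move=> q; apply: cvgM; last exact: cvg_cst.
  by apply: cvgB; (apply: cvgM; last exact: cvg_cst);
    (apply: cvgB; last exact: cvg_cst); [exact: c1|exact: c2].
have cphi2 : continuous (fun q => (phi q).2).
  move=> q; apply: cvgM; last exact: cvg_cst.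
  by apply: cvgB; (apply: cvgM; first exact: cvg_cst);
    (apply: cvgB; last exact: cvg_cst); [exact: c2|exact: c1].
exists phi, psi; split=> //.
  split; first exact: continuous_pair.
  apply: continuous_pair => q; (apply: cvgD; first apply: cvgD;
    first exact: cvg_cst); apply: cvgM; try exact: cvg_cst;
    by [exact: c1|exact: c2].
(* Near [p] the parameters stay in the open unit interval, so being on the line amounts to being on
   the open segment. *)
have near1 : \forall q \near p, s0 + (phi q).1 \in `]0, 1[.
  apply: near_itv01; last by rewrite phip addr0.
  by apply: cvgD; [exact: cvg_cst|exact: cphi1].
have near2 : \forall q \near p, t0 + (phi q).2 \in `]0, 1[.
  apply: near_itv01; last by rewrite phip addr0.
  by apply: cvgD; [exact: cvg_cst|exact: cphi2].
near=> q.
have s1 : s0 + (phi q).1 \in `]0, 1[ by near: q.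
have t1 : t0 + (phi q).2 \in `]0, 1[ by near: q.
have qx := congr1 fst (phiK q); have qy := congr1 snd (phiK q).
split; split.
- case=> s _ <-; rewrite /phi /= -px -py /=; apply/eqP; rewrite mulf_eq0.
  by apply/orP; left; apply/eqP; ring.
- move=> q0; exists (s0 + (phi q).1) => //.
  by rewrite -[RHS]phiK; apply: pair_ext; rewrite /psi q0 mul0r addr0 -?px -?py /=; ring.
- case=> s _ <-; rewrite /phi /= -px' -py' /=; apply/eqP; rewrite mulf_eq0.
  by apply/orP; left; apply/eqP; ring.
- move=> q0; exists (t0 + (phi q).2) => //.
  by rewrite -[RHS]phiK; apply: pair_ext; rewrite /psi q0 mul0r addr0 -?px' -?py' /=; ring.
Unshelve. all: by end_near.
Qed.

End PlaneSegments.

(** * Straight-line drawings *)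

Section OrientedGraphs.
Variables (V : finType) (e : rel V).
Hypothesis e_irr : irreflexive e.

Definition oriented_edges : {set {set V}} :=
  [set A : {set V} | [exists u, exists v, (A == [set u; v]%SET) && e u v]]%SET.

Lemma oriented_edgeP A :
  reflect (exists u v, A = [set u; v]%SET /\ e u v) (A \in oriented_edges).
Proof.
rewrite inE; apply: (iffP existsP) => [[u /existsP[v /andP[/eqP -> uv]]]|[u [v [-> uv]]]].
  by exists u, v.
by exists u; apply/existsP; exists v; rewrite eqxx.
Qed.

Lemma card_oriented_edge A : A \in oriented_edges -> #|A| = 2%N.
Proof.
case/oriented_edgeP => u [v [-> uv]]; rewrite cards2.
by case: eqP uv => // ->; rewrite e_irr.
Qed.

Definition oriented_graph : sgraph V := SGraph card_oriented_edge.

Lemma set2_eq (a b c d : V) : [set a; b]%SET = [set c; d]%SET ->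
  (a = c /\ b = d) \/ (a = d /\ b = c).
Proof.
move=> E.
have : a \in [set c; d]%SET by rewrite -E set21.
have : b \in [set c; d]%SET by rewrite -E set22.
have : c \in [set a; b]%SET by rewrite E set21.
have : d \in [set a; b]%SET by rewrite E set22.
rewrite !inE => /orP[]/eqP -> /orP[]/eqP -> /orP[]/eqP ? /orP[]/eqP ?; subst; auto.
Qed.

Lemma adj_oriented u v : adj oriented_graph u v = e u v || e v u.
Proof.
apply/oriented_edgeP/idP => [[a [b [/set2_eq[[-> ->]|[-> ->]] ->]]]|/orP[]uv].
- by [].
- by rewrite orbT.
- by exists u, v.
- by exists v, u; rewrite finset.setUC.
Qed.

End OrientedGraphs.

Section StraightLineDrawings.
Variables (R : realType) (V : finType) (e : rel V) (P : V -> R * R).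
Hypotheses (e_irr : irreflexive e) (P_inj : injective P).
Hypothesis P_avoid : forall u v w, e u v -> ~ oseg (P u) (P v) (P w).

Let G := oriented_graph e_irr.

(** The enumeration of [A] fixes a direction of travel, possibly opposite to the one in [e]; sets
    without exactly two elements get a junk value. *)
Definition straight_arc (A : {set V}) (t : R) : R * R :=
  if enum A is [:: a; b] then seg (P a) (P b) t else (0, 0).

Lemma straight_arcP A : A \in edges G -> exists u v,
  [/\ A = [set u; v]%SET, straight_arc A = seg (P u) (P v) & e u v || e v u].
Proof.
move=> AG; have := card_edge AG; rewrite cardE /straight_arc.
case E: (enum A) => [|a [|b []]] // _; exists a, b.
have AE : A = [set a; b]%SET by apply/finset.setP => x; rewrite -mem_enum E !inE.
by split=> //; rewrite -(adj_oriented e_irr) /adj -AE.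
Qed.

Lemma straight_arc_inj A : A \in edges G -> injective (straight_arc A).
Proof.
case/straight_arcP => u [v [_ -> uv]]; apply: seg_inj => /P_inj uv'.
by rewrite uv' e_irr in uv.
Qed.

Lemma straight_arc_avoids A : A \in edges G ->
  forall t v, t \in `]0, 1[ -> straight_arc A t <> P v.
Proof.
case/straight_arcP => a [b [_ -> ab]] t v t01 E.
have abv : oseg (P a) (P b) (P v) by exists t.
by case/orP: ab => /P_avoid - /(_ v); [|rewrite osegC].
Qed.

Lemma straight_arc_continuous A : A \in edges G ->
  {within `[0, 1], continuous (straight_arc A)}.
Proof.
case/straight_arcP => a [b [_ -> _]].
by apply: continuous_subspaceT; exact: seg_continuous.
Qed.

Lemma straight_arc_ends A : A \in edges G -> exists u v,
  [/\ A = [set u; v]%SET, straight_arc A 0 = P u & straight_arc A 1 = P v].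
Proof.
by case/straight_arcP => a [b [AE -> _]]; exists a, b; rewrite seg0 seg1.
Qed.

Definition straight_drawing : drawing R G :=
  Drawing P_inj straight_arc_continuous (fun A AG => in2W (@straight_arc_inj A AG))
    straight_arc_ends straight_arc_avoids.

Lemma arc_interior_straight a b : e a b ->
  arc_interior straight_drawing [set a; b]%SET = oseg (P a) (P b).
Proof.
move=> ab; have /straight_arcP[u [v [E sE _]]] : [set a; b]%SET \in edges G.
  by apply/oriented_edgeP; exists a, b.
rewrite /arc_interior /= sE -/(oseg _ _).
by case: (set2_eq E) => [[-> ->]|[-> ->]] //; rewrite osegC.
Qed.

(** [X] prescribes the crossings: pairs outside it are disjoint, pairs inside it are transverse with
    no common end, and each edge has at most one partner. These hypotheses match the clauses of
    [one_plane]. *)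
Variable X : rel (V * V).
Hypothesis X_sep : forall a b c d, e a b -> e c d -> (a, b) != (c, d) ->
  ~~ X (a, b) (c, d) -> oseg (P a) (P b) `&` oseg (P c) (P d) = set0.
Hypothesis X_transverse : forall a b c d, X (a, b) (c, d) ->
  cross_prod (P a) (P b) (P c) (P d) != 0.
Hypothesis X_disjoint : forall a b c d, X (a, b) (c, d) ->
  [disjoint [set a; b]%SET & [set c; d]%SET]%B.
Hypothesis X_functional : forall x y z, X x y -> X x z -> y = z.

Lemma crossing_point_straight a b c d p : e a b -> e c d ->
  crossing_point straight_drawing [set a; b]%SET [set c; d]%SET p ->
  X (a, b) (c, d) /\ (oseg (P a) (P b) `&` oseg (P c) (P d)) p.
Proof.
move=> ab cd [ne]; rewrite !arc_interior_straight // => pI; split=> //.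
apply: contrapT => /negP nX.
have neq : (a, b) != (c, d) by apply: contra ne => /eqP[-> ->].
by move: pI; rewrite X_sep.
Qed.

Lemma straight_one_plane : one_plane straight_drawing.
Proof.
split.
- move=> _ _ p /oriented_edgeP[a [b [-> ab]]] /oriented_edgeP[c [d [-> cd]]].
  case/(crossing_point_straight ab cd) => /X_transverse nz pI.
  by rewrite !arc_interior_straight //; exact: oseg_transversal.
- move=> A B C p q /oriented_edgeP[a [b [-> ab]]].
  move=> /oriented_edgeP[c [d [-> cd]]] /oriented_edgeP[c' [d' [-> cd']]].
  case/(crossing_point_straight ab cd) => Xcd pI.
  case/(crossing_point_straight ab cd') => Xcd' qI.
  have [ec ed] := X_functional Xcd Xcd'; subst c' d'; split=> //.
  exact: oseg_meet_unique (X_transverse Xcd) pI qI.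
- move=> A B /oriented_edgeP[a [b [-> ab]]] /oriented_edgeP[c [d [-> cd]]] nd.
  by case=> p /(crossing_point_straight ab cd)[/X_disjoint dis]; rewrite dis in nd.
Qed.

End StraightLineDrawings.

(** * Three disjoint paths *)

(* The lists s1, s2, s3 are the interiors of three uv-paths. *)
Definition disjoint_paths3 (T : eqType) (r : rel T) (u v : T) (s1 s2 s3 : seq T) :=
  [&& path r u (rcons s1 v), path r u (rcons s2 v), path r u (rcons s3 v),
      uniq (u :: v :: s1 ++ s2 ++ s3) & uniq [:: s1; s2; s3]].

Section ThreeConnectivity.
Variables (V : finType) (G : sgraph V).

Lemma bseq_path u v s : path (adj G) u (rcons s v) -> uniq (u :: v :: s) ->
  exists2 t : {bseq #|V| of V}, t = u :: rcons s v :> seq V & is_path G u v t.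
Proof.
move=> us us_uniq.
have us_uniq' : uniq (u :: rcons s v).
  by rewrite (perm_uniq (s2 := u :: v :: s)) // perm_cons perm_rcons.
have sz : (size (u :: rcons s v) <= #|V|)%N.
  by rewrite -(card_uniqP us_uniq') max_card.
by exists (Bseq sz); rewrite //= /is_path /= eqxx us last_rcons eqxx.
Qed.

Lemma k_connected3 : (4 <= #|V|)%N ->
  (forall u v, u != v -> exists s1 s2 s3, disjoint_paths3 (adj G) u v s1 s2 s3) ->
  k_connected 3 G.
Proof.
move=> V4 H; rewrite /k_connected /kappa.
(* The unit [#|V|.-1] of the iterated minimum is at least 3 because there are four vertices. *)
elim/big_ind: _ => [|m n m3 n3|[u v] /= uv]; first by lia.
  by rewrite leq_min m3 n3.
have [s1 [s2 [s3 /and5P[p1 p2 p3 us s_neq]]]] := H u v uv.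
have sub_uniq s : subseq s (s1 ++ s2 ++ s3) -> uniq (u :: v :: s).
  by move=> ss; apply: subseq_uniq us; rewrite /= !eqxx.
have [t1 t1E t1p] := bseq_path p1 (sub_uniq _ (prefix_subseq _ _)).
have [t2 t2E t2p] := bseq_path p2
  (sub_uniq _ (subseq_trans (prefix_subseq _ _) (suffix_subseq _ _))).
have [t3 t3E t3p] := bseq_path p3
  (sub_uniq _ (subseq_trans (suffix_subseq s2 s3) (suffix_subseq s1 _))).
have rconsE s s' : u :: rcons s v == u :: rcons s' v = (s == s').
  by rewrite eqseq_cons eqxx eqseq_rcons eqxx andbT.
have [d12 d13 d23] : [/\ ~~ has (mem s1) s2, ~~ has (mem s1) s3 & ~~ has (mem s2) s3].
  by move: us; rewrite /= !cat_uniq has_cat negb_or;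
    case/and5P => _ _ _ /andP[-> ->] /and3P[_ -> _].
pose S := [set t1; t2; t3]%SET.
have St t : t \in S -> exists2 s, t = u :: rcons s v :> seq V & s \in [:: s1; s2; s3].
  by rewrite !inE -orbA => /or3P[]/eqP ->; [exists s1|exists s2|exists s3];
    rewrite ?inE ?eqxx ?orbT.
have s_disj s s' x : s \in [:: s1; s2; s3] -> s' \in [:: s1; s2; s3] ->
    s != s' -> x \in s -> x \in s' -> False.
  have no a b : ~~ has (mem a) b -> x \in a -> x \in b -> False.
    by move=> /hasPn nab xa /nab; rewrite /= xa.
  by rewrite !inE => /or3P[]/eqP -> /or3P[]/eqP ->; rewrite ?eqxx // => _ xa xb;
    first [exact: no d12 xa xb|exact: no d12 xb xa|exact: no d13 xa xb
          |exact: no d13 xb xa|exact: no d23 xa xb|exact: no d23 xb xa].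
(* Two empty interiors are disjoint yet give the same path, so [s_neq] is what makes the three paths
   distinct. *)
have S3 : #|S| = 3%N.
  rewrite /S finset.setUC cardsU1 cards2 !inE -!(inj_eq val_inj) /=.
  rewrite t1E t2E t3E !rconsE.
  by move: s_neq; rewrite /= !inE negb_or !andbT ![_ == s3]eq_sym =>
    /andP[/andP[-> /negPf ->] /negPf ->].
rewrite -S3; apply: (@leq_bigmax_cond _ _ (fun S : {set {bseq #|V| of V}} => #|S|)).
apply/andP; split.
  by apply/forall_inP => t; rewrite !inE -orbA => /or3P[]/eqP ->.
apply/forall_inP => t tS; apply/forall_inP => t' t'S; apply/implyP => tt'.
have [s tE sS] := St t tS; have [s' t'E s'S] := St t' t'S.
have ss' : s != s' by rewrite -rconsE -tE -t'E (inj_eq val_inj).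
apply/forallP => x; apply/implyP => /andP[].
rewrite -[x \in t]/(x \in val t) -[x \in t']/(x \in val t') /= tE t'E !inE !mem_rcons !inE.
case: (x == u) => //=; case: (x == v) => //= xs xs'.
by case: (s_disj _ _ _ sS s'S ss' xs xs').
Qed.

End ThreeConnectivity.

(** * Connectedness of plane subgraphs *)

(** Linear-algebra form of the fact that fewer than [n - 1] edges leave a graph on [n] vertices
    disconnected: a potential that is constant along the edges need not be constant. *)
Lemma nonconstant_potential n k (c : 'I_k -> 'I_n * 'I_n) : (k.+1 < n)%N ->
  exists2 x : 'I_n -> rat, forall j, x (c j).1 = x (c j).2 & exists i i', x i != x i'.
Proof.
move=> kn.
(* The signed incidence matrix: its left kernel consists of the potentials constant along every
   edge. *)
pose M : 'M[rat]_(n, k) := \matrix_(i, j) ((i == (c j).1)%:R - (i == (c j).2)%:R).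
have : ~~ (kermx M <= (const_mx 1 : 'rV[rat]_n))%MS.
  (* The kernel has dimension at least [n - k], hence at least 2, whereas the constants span a
     line. *)
  apply/negP => /mxrankS; rewrite mxrank_ker => le1.
  have := rank_leq_col M; have := rank_leq_row (const_mx 1 : 'rV[rat]_n).
  by lia.
case/row_subPn => i ni.
have {i ni} [y yM ny] : exists2 y : 'rV[rat]_n, y *m M = 0 & ~~ (y <= (const_mx 1 : 'rV[rat]_n))%MS.
  by exists (row i (kermx M)) => //; apply/sub_kermxP; exact: row_sub.
exists (y 0) => [j|].
  move/matrixP/(_ 0 j): yM; rewrite !mxE.
  under eq_bigr => l _ do rewrite !mxE mulrBr.
  have sum1 a : \sum_l y 0 l * (l == a)%:R = y 0 a.
    rewrite (bigD1 a) //= eqxx mulr1 big1 ?addr0 // => l /negPf ->.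
    by rewrite mulr0.
  by rewrite sumrB !sum1 => /eqP; rewrite subr_eq0 => /eqP.
apply: contrapT => const; case/negP: ny.
have n0 : (0 < n)%N by lia.
apply/sub_rVP; exists (y 0 (Ordinal n0)); apply/rowP => l.
rewrite !mxE mulr1; apply/eqP/negPn/negP => ne; apply: const.
by exists l, (Ordinal n0).
Qed.

Section Disconnection.
Variables (R : realType) (V : finType) (G : sgraph V) (D : drawing R G).
Variables (n k : nat) (class : V -> 'I_n) (pairs : 'I_k -> (V * V) * (V * V)).

Let left j := [set (pairs j).1.1; (pairs j).1.2]%SET.
Let right j := [set (pairs j).2.1; (pairs j).2.2]%SET.

(* A plane subgraph keeps at most one edge of each crossing pair, and n classes
   cannot be connected by fewer than n - 1 edges. *)
Lemma no_connected_spanning_plane_subgraph :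
  (k.+1 < n)%N -> (forall i, exists v, class v = i) ->
  (forall j, cross D (left j) (right j)) ->
  (forall u v, adj G u v -> class u = class v \/
     exists j, [set u; v]%SET = left j \/ [set u; v]%SET = right j) ->
  ~ exists F, spanning_plane_subgraph D F /\ connected_graph F.
Proof.
move=> kn surj crossing adjG [F [[FG Fplane] Fconn]].
(* The right edge is chosen whenever [F] lacks the left one, whether or not [F] contains the right
   one; since the two cross, no edge of [F] in the pair is missed. *)
pose kept j := if left j \in edges F then (pairs j).1 else (pairs j).2.
have [x xE [i [i' xii']]] :=
  nonconstant_potential (fun j => (class (kept j).1, class (kept j).2)) kn.
have xset (u v a b : V) : [set u; v]%SET = [set a; b]%SET ->
    x (class a) = x (class b) -> x (class u) = x (class v).
  by case/set2_eq => [[-> ->]|[-> ->]].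
have xadj u v : adj F u v -> x (class u) = x (class v).
  move=> uvF; case: (adjG u v (fintype.subsetP FG _ uvF)) => [-> //|[j uvj]].
  have := xE j; rewrite /kept /=; case: ifPn => leftF e.
    case: uvj => uvj; first exact: xset uvj e.
    by case: (Fplane _ _ leftF _ (crossing j)); rewrite -uvj.
  by case: uvj => uvj; [move: leftF; rewrite -uvj [_ \in _]uvF|exact: xset uvj e].
have xconn u v : connect (adj F) u v -> x (class u) = x (class v).
  case/connectP => s; elim: s u => [|w s IHs] u /=; first by move=> _ ->.
  by case/andP => /xadj -> /IHs.
have [u ui] := surj i; have [v vi'] := surj i'.
by move: xii'; rewrite -ui -vi' (xconn u v) ?eqxx.
Qed.

End Disconnection.

(** * The crossed rhombicuboctahedron and its extensions *)

Section CrossedRhombicuboctahedron.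
Local Open Scope nat_scope.

(* Each entry lists the two diagonals of a square, smaller end first; 21, 22 and
   23 are the corners of the outer triangle. *)
Definition square_diagonals : seq ((nat * nat) * (nat * nat)) :=
  [:: ((0, 5), (2, 6)); ((0, 7), (1, 3)); ((0, 9), (3, 6)); ((1, 8), (2, 4));
      ((1, 10), (4, 7)); ((2, 11), (5, 8)); ((3, 17), (9, 14)); ((4, 15), (10, 12));
      ((5, 16), (11, 13)); ((6, 19), (9, 13)); ((7, 20), (10, 14)); ((8, 18), (11, 12));
      ((12, 21), (15, 18)); ((13, 22), (16, 19)); ((14, 23), (17, 20));
      ((15, 23), (20, 21)); ((16, 21), (18, 22)); ((17, 22), (19, 23))].

(** Closing under exchange makes the relation symmetric, and its first components then run through
    all diagonals. *)
Definition crossing_pairs : seq ((nat * nat) * (nat * nat)) :=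
  square_diagonals ++ [seq (x.2, x.1) | x <- square_diagonals].

Definition base_edges : seq (nat * nat) :=
  [:: (21, 22); (21, 23); (22, 23)] ++ unzip1 crossing_pairs.

(* The vertices b > 23 are stacked on the corner 23, away from 21 and 22. *)
Definition new_edge (a b : nat) : bool := (23 < b) && (a \in [:: 21; 22; b.-1]).

Definition nedge (a b : nat) : bool := ((a, b) \in base_edges) || new_edge a b.

Definition nadj (a b : nat) : bool := nedge a b || nedge b a.

(* From i = 23 on the default value applies: the stacked vertices lie on a
   vertical ray from the corner 23. *)
Definition coordinates (i : nat) : nat * nat :=
  nth (10, i - 3)
  [:: (11, 10); (10, 11); (9, 9); (11, 11); (9, 10); (10, 9); (13, 10); (10, 13);
      (7, 7); (14, 12); (8, 12); (8, 6); (6, 7); (13, 9); (11, 14); (5, 7); (13, 8);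
      (12, 15); (6, 4); (16, 12); (8, 14); (0, 0); (20, 10)] i.

Lemma base_edge_bound a b : (a, b) \in base_edges -> a < b < 24.
Proof.
have /allP/[apply] // : all (fun x => x.1 < x.2 < 24) base_edges by vm_compute.
Qed.

Lemma nedge_ltn a b : nedge a b -> a < b.
Proof.
case/orP => [/base_edge_bound/andP[] //|/andP[b24]].
by rewrite !inE => /or3P[]/eqP ->; lia.
Qed.

Lemma nadj_sym : symmetric nadj.
Proof. by move=> a b; rewrite /nadj orbC. Qed.

Lemma nadj_succ a : 23 <= a -> nadj a a.+1.
Proof. by move=> a23; rewrite /nadj /nedge [new_edge a _]/new_edge ltnS a23 !inE eqxx !orbT. Qed.

Lemma nadj_apex a b : a \in [:: 21; 22] -> 22 < b -> nadj a b.
Proof.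
rewrite leq_eqVlt => a2 /orP[/eqP <-|b24].
  by move: a2; rewrite !inE => /orP[]/eqP ->.
have ab : new_edge a b by rewrite /new_edge b24; move: a2; rewrite !inE => /orP[]->; rewrite ?orbT.
by rewrite /nadj /nedge ab orbT.
Qed.

(** * Disjoint paths in the base graph, by computation *)

Definition base_neighbours : seq (seq nat) :=
  [seq [seq w <- iota 0 24 | nadj u w] | u <- iota 0 24].

(* Path interiors of length at most d. The search carries no correctness proof:
   linked_triple and fan_triple check what it finds. *)
Fixpoint detours (nb : seq (seq nat)) d (visited : seq nat) (u v : nat) : seq (seq nat) :=
  (if v \in nth [::] nb u then [:: [::]] else [::]) ++
  if d is d'.+1 then
    flatten [seq [seq w :: s | s <- detours nb d' (w :: visited) w v]
            | w <- nth [::] nb u & (w != v) && (w \notin visited)]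
  else [::].

(** The test [s != t] excludes using the empty interior twice, as it is disjoint from itself. *)
Definition disjoint_triple (L1 L2 L3 : seq (seq nat)) : seq nat * seq nat * seq nat :=
  let ok (s t : seq nat) := ~~ has (mem s) t && (s != t) in
  head ([::], [::], [::]) (flatten [seq flatten [seq [seq (s, t, r)
    | r <- L3 & ok s r && ok t r] | t <- L2 & ok s t] | s <- L1]).

Definition linked_triple (x : nat * nat) : bool :=
  let L := detours base_neighbours 5 [:: x.1] x.1 x.2 in
  let: (s1, s2, s3) := disjoint_triple L L L in
  disjoint_paths3 nadj x.1 x.2 s1 s2 s3 && all (fun w => w < 24) (s1 ++ s2 ++ s3).

Lemma base_linked u v : u < 24 -> v < 24 -> u != v ->
  exists s1 s2 s3, disjoint_paths3 nadj u v s1 s2 s3 /\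
                   all (fun w => w < 24) (s1 ++ s2 ++ s3).
Proof.
have all_linked : all (fun u => all (fun v => (u == v) || linked_triple (u, v))
  (iota 0 24)) (iota 0 24) by lazy.
move=> u24 v24 uv; move/allP: all_linked => /(_ u); rewrite mem_iota => /(_ u24).
move=> /allP/(_ v); rewrite mem_iota => /(_ v24);
  rewrite (negPf uv) /linked_triple [(u, v).1]/= [(u, v).2]/=.
by case: disjoint_triple => [[s1 s2] s3] /andP[? ?]; exists s1, s2, s3.
Qed.

(** Marking the three corners as visited keeps each path of the fan from running through a corner
    before its end. *)
Definition fan_triple (u : nat) : bool :=
  let L := detours base_neighbours 3 [:: u; 21; 22; 23] u in
  let: (s1, s2, s3) := disjoint_triple (L 21) (L 22) (L 23) in
  [&& path nadj u (rcons s1 21), path nadj u (rcons s2 22), path nadj u (rcons s3 23),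
      uniq (u :: s1 ++ s2 ++ s3) & all (fun w => w < 21) (s1 ++ s2 ++ s3)].

Lemma base_fan u : u < 21 -> exists s1 s2 s3,
  [/\ path nadj u (rcons s1 21), path nadj u (rcons s2 22), path nadj u (rcons s3 23),
      uniq (u :: s1 ++ s2 ++ s3) & all (fun w => w < 21) (s1 ++ s2 ++ s3)].
Proof.
have all_fan : all fan_triple (iota 0 21) by lazy.
move=> u21; move/allP: all_fan => /(_ u); rewrite mem_iota => /(_ u21).
rewrite /fan_triple; case: disjoint_triple => [[s1 s2] s3] /and5P[*].
by exists s1, s2, s3; split.
Qed.

(** * Disjoint paths in the presence of stacked vertices *)

Lemma nadj_path a k : 23 <= a -> path nadj a (iota a.+1 k).
Proof. by elim: k a => //= k IHk a a23; rewrite nadj_succ // IHk // leqW. Qed.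

Lemma rcons_iota a k : rcons (iota a k) (a + k) = iota a k.+1.
Proof. by rewrite -addn1 iotaD cats1. Qed.

(** Above the base graph three routes lead to [v]: the edges from 21 and from 22, and the chain of
    stacked vertices. The bound on the interiors does not involve the number of stacked vertices, so
    the paths fit in every graph of the family that contains [v]. *)
Lemma linked u v : u < v -> exists s1 s2 s3,
  disjoint_paths3 nadj u v s1 s2 s3 /\ all (fun w => w < maxn 24 v) (s1 ++ s2 ++ s3).
Proof.
move: (maxn 24 v) (leq_maxl 24 v) (leq_maxr 24 v) => M M24 vM uv; have [v24|v24] := ltnP v 24.
  have [s1 [s2 [s3 [p lt24]]]] := base_linked (ltn_trans uv v24) v24 (negbT (ltn_eqF uv)).
  by exists s1, s2, s3; split=> //; apply: sub_all lt24 => w; lia.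
have apex a b : a \in [:: 21; 22] -> 22 < b -> nadj b a.
  by move=> ? ?; rewrite nadj_sym nadj_apex.
have chain a : 23 <= a < v -> path nadj a (rcons (iota a.+1 (v - a.+1)) v).
  by move=> av; rewrite -[X in rcons _ X](@subnKC a.+1) ?rcons_iota ?nadj_path //; lia.
have v22 : 22 < v by exact: ltnW.
have [u21|u21] := ltnP u 21.
  have [s1 [s2 [s3 [p1 p2 p3 us lt21]]]] := base_fan u21.
  (* The fan of [u] is prolonged: from 21 and 22 directly to [v], from 23 along the chain. *)
  exists (rcons s1 21), (rcons s2 22), (rcons s3 23 ++ iota 24 (v - 24)).
  have lt21' : all (fun w => w < 21) (u :: s1 ++ s2 ++ s3) by rewrite /= u21.
  have v_iota : rcons (iota 24 (v - 24)) v = iota 24 (v - 24).+1.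
    by rewrite -rcons_iota subnKC.
  split; first apply/and5P; first split.
  - by rewrite rcons_path p1 last_rcons nadj_apex.
  - by rewrite rcons_path p2 last_rcons nadj_apex.
  - by rewrite rcons_cat cat_path p3 last_rcons chain //; lia.
  (* Reordered, these are vertices below 21, distinct by the fan, followed by the interval from 21
     to [v]. *)
  - rewrite (@perm_uniq _ _ ((u :: s1 ++ s2 ++ s3) ++ iota 21 3 ++ iota 24 (v - 24).+1)).
      rewrite -iotaD cat_uniq us iota_uniq andbT; apply/hasPn => w.
      rewrite mem_iota => /andP[w21 _]; apply/negP => /(allP lt21').
      by rewrite ltnNge w21.
    by apply/permP => a; rewrite -v_iota /= -!cats1 !count_cat /= !count_cat /=; lia.
  (* The interiors differ in their last vertices, which are 21, 22 and [v - 1]. *)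
  - have neq (s t : seq nat) a b : a != b -> rcons s a != rcons t b.
      by apply: contra; rewrite eqseq_rcons => /andP[].
    rewrite /= !inE negb_or !andbT neq //=; case: (v - 24) => [|k].
      by rewrite cats0 !neq.
    by rewrite -rcons_iota -rcons_cat !neq //; lia.
  - rewrite !all_cat !all_rcons /= in lt21 *.
    have lt21v s : all (fun w => w < 21) s -> all (fun w => w < M) s.
      by apply: sub_all => w; lia.
    case/and3P: lt21 => /lt21v -> /lt21v -> /lt21v ->; rewrite !andbT.
    have -> : all (fun w => w < M) (iota 24 (v - 24)).
      by apply/allP => w; rewrite mem_iota; lia.
    by rewrite !andbT; lia.
have [u23|u23] := ltnP u 23.
  (* Here [u] is 21 or 22, and [43 - u] is the other one; the first path is the edge [uv]. *)
  exists [::], [:: 43 - u], (iota 23 (v - 23)).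
  have v_iota : rcons (iota 23 (v - 23)) v = iota 23 (v - 23).+1.
    by rewrite -rcons_iota subnKC //; lia.
  have u2 : u \in [:: 21; 22] by rewrite !inE; lia.
  have u2' : 43 - u \in [:: 21; 22] by rewrite !inE; lia.
  split; first apply/and5P; first split.
  - by rewrite /= nadj_apex.
  - rewrite /= (nadj_apex u2' v22) !andbT.
    by move: u2; rewrite !inE => /orP[]/eqP ->.
  - by rewrite v_iota /= nadj_apex // nadj_path.
  - rewrite (@perm_uniq _ _ (u :: 43 - u :: iota 23 (v - 23).+1)).
      rewrite cons_uniq in_cons negb_or cons_uniq iota_uniq !mem_iota; lia.
    by apply/permP => a; rewrite -v_iota /= -!cats1 !count_cat /=; lia.
  - have -> : v - 23 = (v - 24).+1 by lia.
    by rewrite /= !inE !eqseq_cons; lia.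
  - rewrite /=; apply/andP; split; first by lia.
    by apply/allP => w; rewrite mem_iota; lia.
exists [:: 21], [:: 22], (iota u.+1 (v - u.+1)).
have v_iota : rcons (iota u.+1 (v - u.+1)) v = iota u.+1 (v - u.+1).+1.
  by rewrite -rcons_iota subnKC.
split; first apply/and5P; first split.
- by rewrite /= apex // nadj_apex.
- by rewrite /= apex // nadj_apex.
- by rewrite chain // u23.
- rewrite (@perm_uniq _ _ (21 :: 22 :: u :: iota u.+1 (v - u.+1).+1)).
    rewrite -[u :: _]/(iota u (v - u.+1).+2) 2!cons_uniq in_cons negb_or.
    by rewrite iota_uniq !mem_iota; lia.
  by apply/permP => a; rewrite -v_iota /= -!cats1 !count_cat /=; lia.
- rewrite /= !inE; case: (v - u.+1) => //= k; rewrite !eqseq_cons; lia.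
- rewrite /=; apply/and3P; split; [by lia|by lia|].
  by apply/allP => w; rewrite mem_iota; lia.
Qed.

End CrossedRhombicuboctahedron.

(** * The drawing *)

Section Placement.
Variable R : realType.

Definition place (i : nat) : R * R := ((coordinates i).1%:R, (coordinates i).2%:R).

(** Integer version of [area], so that orientation tests on placed vertices can be evaluated. *)
Definition areaz (a b c : nat) : int :=
  let: (A, B, C) := (coordinates a, coordinates b, coordinates c) in
  (B.1%:Z - A.1%:Z) * (C.2%:Z - A.2%:Z) - (B.2%:Z - A.2%:Z) * (C.1%:Z - A.1%:Z).

Lemma area_place a b c : area (place a) (place b) (place c) = (areaz a b c)%:~R.
Proof.
by rewrite /area /areaz /place /= rmorphB !rmorphM !rmorphB /= -!pmulrn.
Qed.

(** The bounding lines are the two sides of the outer triangle at the corner 23 and the horizontal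
    through that corner; stacked vertices lie strictly beyond all three. *)
Lemma place_base_bounds i : (i < 24)%N ->
  [/\ (place i).2 <= 2 * (place i).1, (place i).1 + (place i).2 <= 30 & (place i).2 <= 20].
Proof.
move=> i24; have : all (fun i => let c := coordinates i in
    [&& c.2 <= 2 * c.1, c.1 + c.2 <= 30 & c.2 <= 20]%N) (iota 0 24) by vm_compute.
move/allP/(_ i); rewrite mem_iota => /(_ i24) /= /and3P[].
rewrite -!(ler_nat R) natrM natrD => h1 h2 h3; split; [exact: h1|exact: h2|exact: h3].
Qed.

Lemma coordinates_chain i : coordinates (23 + i) = (10, 20 + i)%N.
Proof. by rewrite /coordinates; do 23 (rewrite [(23 + i)%N]/= ); rewrite nth_default //=. Qed.

Lemma place_chain i : (22 < i)%N ->
  exists2 h : nat, i = (23 + h)%N & place i = (10, 20 + h%:R).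
Proof.
move=> i22; exists (i - 23)%N; first by lia.
by rewrite -[i in LHS](subnKC i22) /place coordinates_chain natrD.
Qed.

Lemma place_inj : injective place.
Proof.
move=> i j [/eqP + /eqP]; rewrite !eqr_nat => /eqP e1 /eqP e2.
have {e1 e2} : coordinates i = coordinates j.
  by move: e1 e2; case: (coordinates i) => ? ?; case: (coordinates j) => ? ? /= -> ->.
have low k : (k < 24)%N -> ((coordinates k).2 <= 20)%N.
  by case/place_base_bounds => _ _; rewrite -(ler_nat R).
have [i24|i24] := ltnP i 24; have [j24|j24] := ltnP j 24.
- move=> e; pose s := [seq coordinates k | k <- iota 0 24].
  have s_nth k : (k < 24)%N -> nth (0, 0)%N s k = coordinates k.
    by move=> k24; rewrite (nth_map 0%N) ?size_iota // nth_iota.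
  have s_uniq : uniq s by vm_compute.
  have := @nth_uniq _ (0, 0)%N s i j i24 j24 s_uniq.
  by rewrite !s_nth // e eqxx => /esym/eqP.
- have := low i i24; rewrite -(subnKC j24) -[24%N]/(23 + 1)%N -addnA coordinates_chain => + e.
  by rewrite e /=; lia.
- have := low j j24; rewrite -(subnKC i24) -[24%N]/(23 + 1)%N -addnA coordinates_chain => + e.
  by rewrite -e /=; lia.
- rewrite -(subnKC i24) -(subnKC j24) -[24%N]/(23 + 1)%N -!addnA !coordinates_chain.
  by case; lia.
Qed.

(** A finite check of orientations: the line through one of the two edges has the other edge on one
    side. This covers edges with a common end, where one area is zero and the other is not. *)
Lemma base_not_crossing a b c d : (a, b) \in base_edges -> (c, d) \in base_edges ->
  (a, b) != (c, d) -> ((a, b), (c, d)) \notin crossing_pairs ->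
  oseg (place a) (place b) `&` oseg (place c) (place d) = set0.
Proof.
move=> ab cd ne nX.
have : all (fun x => all (fun y => [|| x == y, (x, y) \in crossing_pairs,
    (0 <= areaz x.1 x.2 y.1 * areaz x.1 x.2 y.2) &&
      ((areaz x.1 x.2 y.1 != 0) || (areaz x.1 x.2 y.2 != 0)) |
    (0 <= areaz y.1 y.2 x.1 * areaz y.1 y.2 x.2) &&
      ((areaz y.1 y.2 x.1 != 0) || (areaz y.1 y.2 x.2 != 0))])
  base_edges) base_edges by vm_compute.
move=> /allP/(_ _ ab)/allP/(_ _ cd); rewrite (negPf ne) (negPf nX) 2!orFb.
case/orP => /andP[ge0 ne0]; last rewrite classical_sets.setIC.
  by apply: oseg_same_side; rewrite !area_place -?intrM ?ler0z ?intr_eq0.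
by apply: oseg_same_side; rewrite !area_place -?intrM ?ler0z ?intr_eq0.
Qed.

Lemma crossing_pairs_meet a b c d : ((a, b), (c, d)) \in crossing_pairs ->
  cross_prod (place a) (place b) (place c) (place d) != 0 /\
  oseg (place a) (place b) `&` oseg (place c) (place d) !=set0.
Proof.
move=> X; have : all (fun x =>
    (areaz x.1.1 x.1.2 x.2.1 * areaz x.1.1 x.1.2 x.2.2 < 0) &&
    (areaz x.2.1 x.2.2 x.1.1 * areaz x.2.1 x.2.2 x.1.2 < 0)) crossing_pairs.
  by vm_compute.
move=> /allP/(_ _ X)/andP[h1 h2].
by apply: oseg_meet; rewrite !area_place -intrM ltrz0.
Qed.

(** The segment from [w] to [w] is the point itself, so avoidance becomes a case of disjointness;
    [w] is never collinear with the ends of the edge. *)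
Lemma base_edge_avoids a b w : (a, b) \in base_edges -> (w < 24)%N ->
  w != a -> w != b -> oseg (place a) (place b) `&` oseg (place w) (place w) = set0.
Proof.
move=> ab w24 wa wb.
have : all (fun x => all (fun w => [|| w == x.1, w == x.2 | areaz x.1 x.2 w != 0])
  (iota 0 24)) base_edges by vm_compute.
move=> /allP/(_ _ ab)/allP/(_ w); rewrite mem_iota (negPf wa) (negPf wb) 2!orFb => /(_ w24) nz.
by apply: oseg_same_side; rewrite area_place; [rewrite -expr2 sqr_ge0|rewrite intr_eq0 nz].
Qed.

Lemma place21 : place 21 = (0, 0). Proof. by []. Qed.

Lemma place22 : place 22 = (20, 10). Proof. by []. Qed.

Lemma new_edge_base a b c d : new_edge a b -> (c < 24)%N -> (d < 24)%N ->
  oseg (place a) (place b) `&` oseg (place c) (place d) = set0.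
Proof.
case/andP => b23 + /place_base_bounds + /place_base_bounds.
move: (place c) (place d) => C D + [c1 c2 c3] [d1 d2 d3].
have [h bE Pb] := place_chain (ltnW b23).
have h1 : 1 <= h%:R :> R by rewrite -[1]/(1%:R) ler_nat; lia.
(* Edges at 21, at 22 and along the chain are cut off by the three lines of [place_base_bounds], in
   this order. *)
rewrite classical_sets.setIC !inE => /or3P[]/eqP ->.
- by apply: (@oseg_separated _ (-2, 1, 0)); rewrite /aff ?place21 ?Pb //=; lra.
- by apply: (@oseg_separated _ (1, 1, -30)); rewrite /aff ?place22 ?Pb //=; lra.
- have b1 : (22 < b.-1)%N by lia.
  have [h' _ Pb'] := place_chain b1; have h'0 : 0 <= h'%:R :> R := ler0n _ _.
  by apply: (@oseg_separated _ (0, 1, -20)); rewrite /aff ?Pb' ?Pb //=; lra.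
Qed.

End Placement.

Section Separation.
Variable R : realType.
Local Notation place := (place R).

(** Writing the upper end as [24 + h] removes the predecessor and gives all heights without
    subtraction. *)
Lemma new_edge_cases a b : new_edge a b -> exists2 h : nat,
  b = (24 + h)%N /\ place b = (10, 21 + h%:R) &
  [\/ a = 21%N /\ place a = (0, 0), a = 22%N /\ place a = (20, 10) |
      a = (23 + h)%N /\ place a = (10, 20 + h%:R)].
Proof.
case/andP => b24 aE; have [h bE Pb] := place_chain R (ltnW b24).
have [k hE] : exists k, h = k.+1 by exists h.-1; lia.
subst h; exists k.
  by split; [lia|rewrite Pb; congr pair; rewrite -natr1; ring].
move: aE; rewrite !inE bE addnS -pred_Sn => /or3P[]/eqP ->; [exact: Or31|exact: Or32|apply: Or33].
by split=> //; have [] := @place_chain R (23 + k)%N => // l /addnI ->.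
Qed.

(** The vertical line [x = 10] contains the chain and has the edges at 21 on its left and those at
    22 on its right. Edges at the same corner have different slopes, and chain edges occupy
    successive height intervals. *)
Lemma new_edges_disjoint a b c d : new_edge a b -> new_edge c d -> (a, b) != (c, d) ->
  oseg (place a) (place b) `&` oseg (place c) (place d) = set0.
Proof.
move=> /new_edge_cases[h [-> ->] A] /new_edge_cases[k [-> ->] C] ne.
have chain_chain i j : (i < j)%N ->
    oseg (10, 20 + i%:R) (10, 21 + i%:R) `&` oseg (10, 20 + j%:R) (10, 21 + j%:R)
    = set0 :> set (R * R).
  rewrite -(ler_nat R) -natr1 => ij.
  by apply: (@oseg_separated _ (0, 1, - (21 + i%:R))); rewrite /aff /=; lra.
case: A C => [[aE ->]|[aE ->]|[aE ->]] [[cE ->]|[cE ->]|[cE ->]].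
- have hk : h%:R != k%:R :> R by rewrite eqr_nat; apply: contra ne => /eqP->; rewrite aE cE.
  apply: oseg_same_side; first by rewrite /area /=; lra.
  by apply/orP; right; rewrite /area /=; apply: contra hk => /eqP ?; apply/eqP; lra.
- by apply: (@oseg_separated _ (1, 0, -10)); rewrite /aff /=; lra.
- by apply: (@oseg_separated _ (1, 0, -10)); rewrite /aff /=; lra.
- by apply: (@oseg_separated _ (-1, 0, 10)); rewrite /aff /=; lra.
- have hk : h%:R != k%:R :> R by rewrite eqr_nat; apply: contra ne => /eqP->; rewrite aE cE.
  apply: oseg_same_side; first by rewrite /area /=; lra.
  by apply/orP; right; rewrite /area /=; apply: contra hk => /eqP ?; apply/eqP; lra.
- by apply: (@oseg_separated _ (-1, 0, 10)); rewrite /aff /=; lra.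
- by apply: (@oseg_separated _ (-1, 0, 10)); rewrite /aff /=; lra.
- by apply: (@oseg_separated _ (1, 0, -10)); rewrite /aff /=; lra.
- case: (ltngtP h k) => [|kh|hk]; first exact: chain_chain.
    by rewrite classical_sets.setIC; exact: chain_chain.
  by case/eqP: ne; rewrite aE cE hk.
Qed.

Lemma new_edge_avoids a b w : new_edge a b -> (24 <= w)%N ->
  oseg (place a) (place b) `&` oseg (place w) (place w) = set0.
Proof.
move=> /new_edge_cases[h [bE ->] A] /ltnW /(place_chain R)[k wE ->].
case: A => [[aE ->]|[aE ->]|[aE ->]].
- by apply: (@oseg_separated _ (1, 0, -10)); rewrite /aff /=; lra.
- by apply: (@oseg_separated _ (-1, 0, 10)); rewrite /aff /=; lra.
- have [|] := leqP k h; rewrite -(ler_nat R) -?natr1 => kh.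
    by apply: (@oseg_separated _ (0, -1, 20 + h%:R)); rewrite /aff /=; lra.
  by apply: (@oseg_separated _ (0, 1, - (21 + h%:R))); rewrite /aff /=; lra.
Qed.

Lemma nedge_separated a b c d : nedge a b -> nedge c d -> (a, b) != (c, d) ->
  ((a, b), (c, d)) \notin crossing_pairs ->
  oseg (place a) (place b) `&` oseg (place c) (place d) = set0.
Proof.
have bound x y : (x, y) \in base_edges -> (x < 24)%N /\ (y < 24)%N.
  by move/base_edge_bound => /andP[xy y24]; split=> //; exact: ltn_trans xy y24.
case/orP => ab /orP[] cd ne nX.
- exact: base_not_crossing.
- have [a24 b24] := bound _ _ ab; rewrite classical_sets.setIC; exact: new_edge_base.
- have [c24 d24] := bound _ _ cd; exact: new_edge_base.
- exact: new_edges_disjoint.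
Qed.

Lemma oseg_endpoint (p q : R * R) : p <> q -> ~ oseg p q p.
Proof.
move=> pq [t t01 tp]; have t0 : t = 0 by apply: (seg_inj pq); rewrite seg0.
by move: t01; rewrite t0 /= in_itv /= ltxx.
Qed.

Lemma nedge_avoids a b w : nedge a b -> ~ oseg (place a) (place b) (place w).
Proof.
move=> ab; have ab' : place a <> place b.
  by move/place_inj => e; move: (nedge_ltn ab); rewrite e ltnn.
have [->|wa] := eqVneq w a; first exact: oseg_endpoint.
have [->|wb] := eqVneq w b; first by rewrite osegC; apply: oseg_endpoint => /esym.
(* Avoidance is turned into disjointness from a degenerate segment, with the parameter [2^-1] as an
   arbitrary interior one. *)
suff E : oseg (place a) (place b) `&` oseg (place w) (place w) = set0.
  move=> abw; suff : set0 (place w) by [].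
  rewrite -E; split=> //; exists 2^-1; first by rewrite /= in_itv /=; lra.
  by apply: pair_ext; rewrite /= subrr mulr0 addr0.
have [w24|w24] := ltnP w 24; case/orP: ab => ab.
- exact: base_edge_avoids.
- exact: new_edge_base.
- have /andP[a_b b24] := base_edge_bound ab.
  have [_ _ a3] := place_base_bounds R (ltn_trans a_b b24).
  have [_ _ b3] := place_base_bounds R b24.
  have [h wE ->] := place_chain R (ltnW w24).
  have h1 : 1 <= h%:R :> R by rewrite -[1]/(1%:R) ler_nat; lia.
  move: (place a) (place b) a3 b3 => A B a3 b3.
  by apply: (@oseg_separated _ (0, 1, -20)); rewrite /aff /=; lra.
- exact: new_edge_avoids.
Qed.

End Separation.

(** * The graphs of the theorem *)

(** Reversal extends [linked], proved for [u < v], to both orders of the ends. *)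
Lemma disjoint_paths3_rev (T : eqType) (r : rel T) u v s1 s2 s3 : symmetric r ->
  disjoint_paths3 r u v s1 s2 s3 -> disjoint_paths3 r v u (rev s1) (rev s2) (rev s3).
Proof.
move=> r_sym.
have rev_r s : path r v (rcons (rev s) u) = path r u (rcons s v).
  rewrite -rev_cons -(belast_rcons u s v) -[v in path r v](last_rcons u s v) rev_path.
  by apply: eq_path => x y; exact: r_sym.
have uniq_rev (T' : eqType) (f : T' -> T') a b c : injective f ->
    uniq [:: f a; f b; f c] = uniq [:: a; b; c].
  by move=> f_inj; exact: (map_inj_uniq f_inj [:: a; b; c]).
case/and5P => p1 p2 p3 us ds; apply/and5P; split; rewrite ?rev_r //.
  rewrite (perm_uniq (s2 := u :: v :: s1 ++ s2 ++ s3)) //.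
  by apply/permP => a; rewrite /= !count_cat !count_rev; lia.
by rewrite uniq_rev //; exact: (can_inj revK).
Qed.

Lemma crossing_pairs_uniq a b c d : ((a, b), (c, d)) \in crossing_pairs ->
  uniq [:: a; b; c; d].
Proof.
by have /allP/[apply] : all (fun x => uniq [:: x.1.1; x.1.2; x.2.1; x.2.2]) crossing_pairs
  by vm_compute.
Qed.

Lemma crossing_pairs_functional x y z :
  (x, y) \in crossing_pairs -> (x, z) \in crossing_pairs -> y = z.
Proof.
move=> xy xz.
have : all (fun p => all (fun q => (p.1 == q.1) ==> (p.2 == q.2)) crossing_pairs)
  crossing_pairs by vm_compute.
by move=> /allP/(_ _ xy)/allP/(_ _ xz)/implyP/(_ (eqxx x))/eqP.
Qed.

Section CrossedGraph.
Variables (R : realType) (m : nat).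

(** The [24 + m] vertices are indexed by a visible successor, so that [inord] applies; [m] counts
    the stacked ones. *)
Definition nedge_ord : rel 'I_(23 + m).+1 := fun i j => nedge i j.

Lemma nedge_ord_irr : irreflexive nedge_ord.
Proof. by move=> i; apply/negP => /nedge_ltn; rewrite ltnn. Qed.

Definition crossed_graph := oriented_graph nedge_ord_irr.

Definition place_ord (i : 'I_(23 + m).+1) : R * R := place R i.

Lemma place_ord_inj : injective place_ord.
Proof. by move=> i j /place_inj /val_inj. Qed.

Lemma nedge_ord_avoids u v w : nedge_ord u v ->
  ~ oseg (place_ord u) (place_ord v) (place_ord w).
Proof. exact: nedge_avoids. Qed.

Definition crossed_drawing := straight_drawing nedge_ord_irr place_ord_inj nedge_ord_avoids.

Lemma crossed_one_plane : one_plane crossed_drawing.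
Proof.
pose nat_pair (x : 'I_(23 + m).+1 * 'I_(23 + m).+1) : nat * nat := (val x.1, val x.2).
apply: (@straight_one_plane _ _ _ _ _ _ _
  (fun x y => (nat_pair x, nat_pair y) \in crossing_pairs)).
- by move=> a b c d ab cd ne; exact: nedge_separated.
- by move=> a b c d /(crossing_pairs_meet R)[].
- move=> a b c d /crossing_pairs_uniq.
  rewrite /= !inE !negb_or !andbT => /and3P[/and3P[_ ac ad] /andP[bc bd] _].
  rewrite -setI_eq0; apply/eqP/finset.setP => x; rewrite !inE.
  by apply/negP => /andP[/orP[]/eqP -> /orP[]/eqP e]; move: ac ad bc bd; rewrite -e eqxx.
- move=> [a b] [c d] [c' d'] X X'.
  by have [/val_inj -> /val_inj ->] := crossing_pairs_functional X X'.
Qed.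

Lemma crossed_three_connected : k_connected 3 crossed_graph.
Proof.
apply: k_connected3 => [|u v]; first by rewrite card_ord.
have adjE a b : adj crossed_graph a b = nadj a b by exact: adj_oriented.
have adj_sym : symmetric (adj crossed_graph) by move=> a b; rewrite !adjE nadj_sym.
wlog uv : u v / (u < v)%N => [H ne|_].
  have [uv|vu|/val_inj e] := ltngtP u v; first exact: H.
    have [//||s1 [s2 [s3 p]]] := H v u; first by rewrite eq_sym.
    by exists (rev s1), (rev s2), (rev s3); exact: disjoint_paths3_rev p.
  by rewrite e eqxx in ne.
have [s1 [s2 [s3 [/and5P[p1 p2 p3 us ds] lt_v]]]] := linked uv.
have M : (maxn 24 v <= (23 + m).+1)%N by have := ltn_ord v; lia.
have {lt_v M} : all (fun w => w < (23 + m).+1)%N (s1 ++ s2 ++ s3).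
  by apply: sub_all lt_v => w /leq_trans; exact.
rewrite !all_cat => /and3P[l1 l2 l3].
(* The bound on the interiors makes [inord] faithful on them, so adjacency and distinctness carry
   over from natural numbers. *)
pose f : nat -> 'I_(23 + m).+1 := inord.
have fK s : all (fun w => w < (23 + m).+1)%N s -> map val (map f s) = s.
  by elim: s => //= w s IHs /andP[wm /IHs ->]; rewrite inordK.
have f_path s : all (fun w => w < (23 + m).+1)%N s -> path nadj u (rcons s v) ->
    path (adj crossed_graph) u (rcons (map f s) v).
  move=> ls; rewrite -{2}(inord_val u) -{2}(inord_val v) -map_rcons path_map.
  apply: (sub_in_path (P := fun w => w < (23 + m).+1)%N).
    by move=> a b /= am bm; rewrite adjE !inordK.
  by rewrite /= ltn_ord all_rcons ltn_ord.
exists (map f s1), (map f s2), (map f s3); apply/and5P; split; try exact: f_path.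
  apply: (@map_uniq _ _ val).
  by rewrite /= !map_cat !fK.
apply: (@map_uniq _ _ (map val)).
by rewrite /= -!/(map val _) !fK.
Qed.

Lemma crossed_no_connected_spanning :
  ~ exists F, spanning_plane_subgraph crossed_drawing F /\ connected_graph F.
Proof.
pose f (x : nat * nat) : 'I_(23 + m).+1 * 'I_(23 + m).+1 := (inord x.1, inord x.2).
pose q (j : 'I_18) := nth ((0, 0), (0, 0))%N square_diagonals j.
have q_mem j : q j \in square_diagonals by exact: mem_nth.
have inord24 a : (a < 24)%N -> (inord a : 'I_(23 + m).+1) = a :> nat.
  by move=> a24; rewrite inordK //; lia.
(* Truncation at 21 merges the outer triangle and all stacked vertices into one class: 22 classes
   against 18 crossing pairs. *)
refine (@no_connected_spanning_plane_subgraph _ _ _ crossed_drawing 22%N 18%N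
  (fun v => inord (minn v 21)%N : 'I_22) (fun j => (f (q j).1, f (q j).2)) _ _ _ _) => //.
- move=> i; exists (inord i); have := ltn_ord i => i22.
  by apply: val_inj; rewrite /= inord24 ?inordK; lia.
- move=> j; have := q_mem j; case: (q j) => [[a b] [c d]] /= X.
  have X1 : ((a, b), (c, d)) \in crossing_pairs by rewrite mem_cat X.
  have X2 : ((c, d), (a, b)) \in crossing_pairs.
    by rewrite mem_cat orbC (map_f (fun x => (x.2, x.1)) X).
  have base x y : (x, y) \in crossing_pairs -> x \in base_edges.
    by move=> xy; rewrite mem_cat orbC (map_f fst xy).
  have /andP[ab b24] := base_edge_bound (base _ _ X1).
  have /andP[cd d24] := base_edge_bound (base _ _ X2).
  have a24 := ltn_trans ab b24; have c24 := ltn_trans cd d24.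
  have e1 : nedge_ord (inord a) (inord b).
    by rewrite /nedge_ord !inord24 // /nedge (base _ _ X1).
  have e2 : nedge_ord (inord c) (inord d).
    by rewrite /nedge_ord !inord24 // /nedge (base _ _ X2).
  have [_ [p pI]] := crossing_pairs_meet R X1.
  exists p; split; last first.
    by rewrite !arc_interior_straight // /place_ord !inord24.
  apply/eqP => /set2_eq; move: (crossing_pairs_uniq X1).
  rewrite /= !inE !negb_or => /and3P[/and3P[_ /negP ac /negP ad] _ _].
  by case=> -[/(congr1 val)/= + _]; rewrite !inord24 // => /eqP.
- have oriented (u v : 'I_(23 + m).+1) : nedge u v ->
      (minn u 21 = minn v 21)%N \/ exists j, (val u, val v) = (q j).1 \/ (val u, val v) = (q j).2.
    have mem_q x : x \in square_diagonals -> exists j, q j = x.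
      move=> xs; have x18 : (index x square_diagonals < 18)%N by rewrite -index_mem in xs.
      by exists (Ordinal x18); rewrite /q nth_index.
    case/orP; last first.
      by case/andP => v23; rewrite !inE => /or3P[]/eqP uE; left; lia.
    rewrite mem_cat => /orP[|/mapP[[x y]]].
      by rewrite !inE => /or3P[]/eqP[-> ->]; left.
    rewrite mem_cat => /orP[xy ->|/mapP[[z t] zt [-> ->]] ->]; right.
      by have [j qj] := mem_q _ xy; exists j; left; rewrite qj.
    by have [j qj] := mem_q _ zt; exists j; right; rewrite qj.
  have f_val u v x : (val u, val v) = x -> f x = (u, v).
    by move=> <-; rewrite /f /= !inord_val.
  move=> u v; rewrite [adj _ _ _]adj_oriented => /orP[]/oriented[e|[j e]].
  + by left; congr inord.
  + by right; exists j; case: e => /f_val ->; [left|right].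
  + by left; congr inord.
  + by right; exists j; rewrite finset.setUC; case: e => /f_val ->; [left|right].
Qed.

End CrossedGraph.

Theorem theorem2 (R : realType) :
  exists G : nat -> one_plane_graph R,
    (forall i : nat,
        k_connected 3 (graph (G i)) /\
        ~ (exists F : sgraph (vertex (G i)),
              spanning_plane_subgraph (graph_drawing (G i)) F /\
              connected_graph F)) /\
    (forall i j : nat, i <> j -> ~ isomorphic (graph (G i)) (graph (G j))).
Proof.
exists (fun m => OnePlaneGraph (@crossed_one_plane R m)); split=> [m|i j ij [f f_bij _]].
  by split; [exact: crossed_three_connected|exact: crossed_no_connected_spanning].
(* The vertex sets have [24 + i] and [24 + j] elements, so no bijection exists for distinct
   indices. *)
by apply: ij; have := bij_eq_card f_bij; rewrite !card_ord => -[/addnI].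
Qed.
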